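(* Let $\Lambda$ be a commutative Noetherian ring, let $I=\langle\nu_1,\ldots,\nu_s\rangle$ be a proper ideal of $\Lambda$ with $\nu_1,\ldots,\nu_s\in I$, and let $R=\Lambda/I$. If linear equations are solvable in $\Lambda$, then linear equations are solvable in $R$.
   Context: Linear equations are said to be solvable in a commutative Noetherian ring $\Lambda$ provided that: (i) given $\lambda,\lambda_1,\ldots,\lambda_m\in\Lambda$, there is an algorithm to determine whether $\lambda\in\langle\lambda_1,\ldots,\lambda_m\rangle$ and, if it is, to compute $\mu_1,\ldots,\mu_m\in\Lambda$ such that $\lambda=\lambda_1\mu_1+\cdots+\lambda_m\mu_m$; (ii) given $\lambda_1,\ldots,\lambda_m\in\Lambda$, there is an algorithm that computes a set of generators for the $\Lambda$-module $\mathrm{Syz}_\Lambda(\lambda_1,\ldots,\lambda_m)=\{(\mu_1,\ldots,\mu_m)\in\Lambda^m\mid\lambda_1\mu_1+\cdots+\lambda_m\mu_m=0\}$. Elements of $R=\Lambda/I$ are given by representatives in $\Lambda$. *)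

(* Defs.v *)
From HB Require Import structures.
From mathcomp Require Import all_boot all_algebra.

Set Implicit Arguments.
Unset Strict Implicit.
Unset Printing Implicit Defensive.

Import GRing.Theory.
Local Open Scope ring_scope.
Local Open Scope quotient_scope.

(** The model of computation is the language I of N. D. Jones, "Computability
    and Complexity from a Programming Perspective" (MIT Press, 1997): WHILE
    programs over binary trees with the single variable X, which Jones proves
    to compute exactly the Turing-computable functions. *)

Inductive data : Type := Nil | Cons of data & data.

Inductive expr : Type :=
| EVar
| ENil
| ECons of expr & expr
| EHd of expr
| ETl of expr.

Inductive prog : Type :=
| PAssign of expr
| PSeq of prog & prog
| PWhile of expr & prog.

Definition hd (d : data) : data := if d is Cons a _ then a else Nil.
Definition tl (d : data) : data := if d is Cons _ b then b else Nil.

Fixpoint eval (e : expr) (x : data) : data :=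
  match e with
  | EVar => x
  | ENil => Nil
  | ECons e1 e2 => Cons (eval e1 x) (eval e2 x)
  | EHd e1 => hd (eval e1 x)
  | ETl e1 => tl (eval e1 x)
  end.

(** [exec p x y]: started with X = [x], the program [p] halts with X = [y].
    A loop runs as long as its test evaluates to a tree other than [Nil]. *)
Inductive exec : prog -> data -> data -> Prop :=
| ExecAssign e x : exec (PAssign e) x (eval e x)
| ExecSeq p q x y z : exec p x y -> exec q y z -> exec (PSeq p q) x z
| ExecWhileStop e p x : eval e x = Nil -> exec (PWhile e p) x x
| ExecWhileStep e p x y z :
    eval e x <> Nil -> exec p x y -> exec (PWhile e p) y z ->
    exec (PWhile e p) x z.

Definition enc_seq : seq data -> data := foldr Cons Nil.

Definition enc_mx k m (D : 'M[data]_(k, m)) : data :=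
  enc_seq [seq enc_seq [seq D i j | j <- enum 'I_m] | i <- enum 'I_k].

Definition enc_row m (d : 'rV[data]_m) : data :=
  enc_seq [seq d ord0 j | j <- enum 'I_m].

(** A tree may name no element, and an element may have several names. *)
Record naming (T : Type) := Naming {
  decode :> data -> option T;
  decode_surj : forall x, exists d, decode d = Some x
}.

Definition names T (delta : naming T) k m
  (D : 'M[data]_(k, m)) (M : 'M[T]_(k, m)) : Prop :=
  forall i j, delta (D i j) = Some (M i j).

Section Linear.

Variable A : comNzRingType.

Definition lincomb m (l mu : 'rV[A]_m) : A := \sum_i l 0 i * mu 0 i.

Definition gen_ideal m (l : 'rV[A]_m) (x : A) : Prop :=
  exists mu : 'rV[A]_m, x = lincomb l mu.

Definition noetherian : Prop :=
  forall J : A -> Prop,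
    J 0 -> (forall x y, J x -> J y -> J (x + y)) ->
    (forall a x, J x -> J (a * x)) ->
  exists m (g : 'rV[A]_m), forall x, J x <-> gen_ideal g x.

Definition syz m (l mu : 'rV[A]_m) : Prop := lincomb l mu = 0.

Definition rows_generate m k (G : 'M[A]_(k, m)) (M : 'rV[A]_m -> Prop) : Prop :=
  forall mu, M mu <-> exists c : 'rV[A]_k, mu = c *m G.

(** The output [Nil] means "not a member"; the output [Cons Nil e] means
    "member", with coefficients [e]. *)
Definition solves_membership (delta : naming A) (p : prog) : Prop :=
  forall m (d : data) (ds : 'rV[data]_m) (x : A) (l : 'rV[A]_m),
    delta d = Some x -> names delta ds l ->
  exists2 out, exec p (Cons d (enc_row ds)) out &
    (out = Nil /\ ~ gen_ideal l x) \/
    (exists (es : 'rV[data]_m) (mu : 'rV[A]_m),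
      [/\ out = Cons Nil (enc_row es), names delta es mu & x = lincomb l mu]).

Definition solves_syzygies (delta : naming A) (p : prog) : Prop :=
  forall m (ds : 'rV[data]_m) (l : 'rV[A]_m),
    names delta ds l ->
  exists k (E : 'M[data]_(k, m)) (G : 'M[A]_(k, m)),
    [/\ exec p (enc_row ds) (enc_mx E), names delta E G &
        rows_generate G (syz l)].

Definition linear_equations_solvable (delta : naming A) : Prop :=
  (exists p, solves_membership delta p) /\ (exists p, solves_syzygies delta p).

End Linear.

Section Quotient.

(** An [idealr] is by definition proper: it does not contain 1. *)
Variables (A : comNzRingType) (I : idealr A).

Lemma quot_decode_surj (delta : naming A) (y : {ideal_quot I}) :
  exists d, omap \pi_{ideal_quot I} (delta d) = Some y.
Proof.
have [d Hd] := decode_surj delta (repr y).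
by exists d; rewrite Hd /= reprK.
Qed.

(** A class is named by the names of its representatives. *)
Definition quot_naming (delta : naming A) : naming {ideal_quot I} :=
  Naming (quot_decode_surj delta).

Lemma noetherian_quot : noetherian A -> noetherian {ideal_quot I}.
Proof.
move=> nA J J0 JD JM.
have [|x y Jx Jy|a x Jx|m [g Hg]] := nA (fun x => J (\pi_{ideal_quot I} x)).
- by rewrite rmorph0.
- by rewrite rmorphD; apply: JD.
- by rewrite rmorphM; apply: JM.
exists m, (map_mx \pi_{ideal_quot I} g) => y; split=> [Jy|[mu ->]].
  have [mu E] : gen_ideal g (repr y) by apply/Hg; rewrite reprK.
  exists (map_mx \pi_{ideal_quot I} mu); rewrite -[y]reprK E /lincomb rmorph_sum.
  by apply: eq_bigr => i _; rewrite !mxE rmorphM.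
have <- : \pi_{ideal_quot I} (lincomb g (map_mx repr mu)) =
    lincomb (map_mx \pi_{ideal_quot I} g) mu.
  rewrite /lincomb rmorph_sum; apply: eq_bigr => i _.
  by rewrite !mxE rmorphM; congr (_ * _); apply: reprK.
by apply/Hg; exists (map_mx repr mu).
Qed.

End Quotient.

(* Main.v *)
(** With [I] generated by [nu], the class of [x] lies in the ideal generated by
    the classes of [l] iff [x] lies in the ideal generated by [nu] and [l], and
    the syzygies of the classes of [l] are the classes of the syzygies of
    [(nu, l)] with their first [s] entries dropped.  So both algorithms over the
    quotient prepend the constant names of [nu] to the input, call the algorithm
    over the base ring, and drop the first [s] entries of every row returned. *)

From mathcomp Require Import all_boot all_algebra.
Require Import Defs.

Set Implicit Arguments.
Unset Strict Implicit.
Unset Printing Implicit Defensive.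

Import GRing.Theory.
Local Open Scope ring_scope.
Local Open Scope quotient_scope.

(** * Enumeration of ordinals and permutation of rows *)

Lemma enum_ord_add m n :
  enum 'I_(m + n) = map (@lshift m n) (enum 'I_m) ++ map (@rshift m n) (enum 'I_n).
Proof.
(* Passing to values reduces the claim to splitting [iota 0 (m + n)] at [m]. *)
apply: (inj_map val_inj).
rewrite val_enum_ord map_cat -[map val (map (@lshift m n) _)]map_comp
  -[map val (map (@rshift m n) _)]map_comp iotaD add0n -[m in iota m n]addn0 iotaDl.
rewrite -[in iota 0 m](val_enum_ord m) -[iota 0 n](val_enum_ord n) -map_comp.
by congr (_ ++ _); apply: eq_map.
Qed.

(** Serves to express the reversal of a list of rows as a permutation of the rows of a matrix. *)
Lemma rev_enum_ord n : rev (enum 'I_n) = map (@rev_ord n) (enum 'I_n).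
Proof.
(* The empty case is separate because [ord0], the default value for [nth], needs a nonempty ordinal
   type. *)
case: n => [|n]; first by rewrite !enum_ord0.
apply: (@eq_from_nth _ ord0) => [|i]; first by rewrite size_rev (size_map (@rev_ord _)).
rewrite size_rev size_enum_ord => lti.
rewrite nth_rev ?size_enum_ord // (nth_map ord0) ?size_enum_ord //.
by apply: val_inj; rewrite /= !nth_enum_ord // subSS ltnS leq_subr.
Qed.

Lemma mulmx_rowsub_perm (R : pzSemiRingType) m k n (f : 'I_k -> 'I_k)
    (c : 'M[R]_(m, k)) (G : 'M[R]_(k, n)) :
  injective f -> colsub f c *m rowsub f G = c *m G.
Proof.
move=> f_inj; apply/matrixP=> i j; rewrite !mxE [RHS](reindex_inj f_inj).
by apply: eq_bigr => h _; rewrite !mxE.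
Qed.

(** * Programs that prepend constants and drop entries *)

Fixpoint quote (d : data) : expr :=
  if d is Cons a b then ECons (quote a) (quote b) else ENil.

Lemma eval_quote d x : eval (quote d) x = d.
Proof. by elim: d => //= a -> b ->. Qed.

(** The trees in [s] are fixed when the program is built, so they enter it as constant
    expressions. *)
Definition prepend (s : seq data) (e : expr) : expr :=
  foldr (fun d => ECons (quote d)) e s.

Lemma eval_prepend s e x : eval (prepend s e) x = foldr Cons (eval e x) s.
Proof. by elim: s => //= d s ->; rewrite eval_quote. Qed.

Lemma eval_iter_tl n e x : eval (iter n ETl e) x = iter n tl (eval e x).
Proof. by elim: n => //= n ->. Qed.

Lemma iter_tl_foldr s x : iter (size s) tl (foldr Cons x s) = x.
Proof. by elim: s => //= d s IHs; rewrite -iterS iterSr. Qed.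

Lemma enc_row_mx m n (d : 'rV[data]_m) (e : 'rV[data]_n) :
  enc_row (row_mx d e) = foldr Cons (enc_row e) [seq d ord0 j | j <- enum 'I_m].
Proof.
rewrite /enc_row enum_ord_add map_cat -!map_comp /enc_seq foldr_cat.
by congr (foldr _ (foldr _ _ _) _); apply: eq_map => j /=;
  rewrite ?row_mxEl ?row_mxEr.
Qed.

Lemma iter_tl_enc_row m n (d : 'rV[data]_(m + n)) :
  iter m tl (enc_row d) = enc_row (rsubmx d).
Proof.
rewrite -[d in LHS]hsubmxK enc_row_mx.
by rewrite -[X in iter X](size_enum_ord m) -(size_map (lsubmx d ord0)) iter_tl_foldr.
Qed.

Lemma enc_mxE k m (D : 'M[data]_(k, m)) :
  enc_mx D = enc_seq [seq enc_row (row i D) | i <- enum 'I_k].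
Proof.
by congr enc_seq; apply: eq_map => i; congr enc_seq; apply: eq_map => j; rewrite mxE.
Qed.

(* The pair of a flag and [x] serves as the state of a loop that runs at most
   once: this is how the language expresses a conditional. *)
Definition drop_coeffs (s : nat) : prog :=
  PSeq (PAssign (ECons EVar EVar))
    (PSeq (PWhile (EHd EVar)
             (PAssign (ECons ENil (ECons ENil (iter s ETl (ETl (ETl EVar)))))))
       (PAssign (ETl EVar))).

Lemma exec_drop_coeffs_Nil s : exec (drop_coeffs s) Nil Nil.
Proof.
apply: ExecSeq; first exact: ExecAssign.
by apply: ExecSeq; [apply: ExecWhileStop | apply: (ExecAssign (ETl EVar))].
Qed.

Lemma exec_drop_coeffs s x :
  exec (drop_coeffs s) (Cons Nil x) (Cons Nil (iter s tl x)).
Proof.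
apply: ExecSeq; first exact: ExecAssign.
apply: ExecSeq.
  apply: ExecWhileStep => //; first exact: ExecAssign.
  exact: ExecWhileStop.
rewrite /= eval_iter_tl /=.
exact: (ExecAssign (ETl EVar) (Cons Nil (Cons Nil (iter s tl x)))).
Qed.

(* The state is a pair of the rows still to be treated and an accumulator, so
   the rows come out in reverse order. *)
Definition drop_rows_loop (s : nat) : prog :=
  PWhile (EHd EVar)
    (PAssign (ECons (ETl (EHd EVar))
       (ECons (iter s ETl (EHd (EHd EVar))) (ETl EVar)))).

Definition drop_rows (s : nat) : prog :=
  PSeq (PAssign (ECons EVar ENil)) (PSeq (drop_rows_loop s) (PAssign (ETl EVar))).

Lemma exec_drop_rows_loop s r a :
  exec (drop_rows_loop s) (Cons (enc_seq r) (enc_seq a))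
    (Cons Nil (enc_seq (catrev (map (iter s tl) r) a))).
Proof.
elim: r a => [|d r IHr] a /=; first exact: ExecWhileStop.
apply: ExecWhileStep (IHr (iter s tl d :: a)) => //.
(* As [s] is a variable, [eval] does not reduce through [iter s ETl]; the trimmed row is restated as
   a value of [eval] so that [ExecAssign] unifies. *)
by rewrite -[iter s tl d](eval_iter_tl s (EHd (EHd EVar)) (Cons (Cons d (enc_seq r)) (enc_seq a)));
  apply: ExecAssign.
Qed.

(** The reversal caused by the accumulator is recorded by [rev_ord]; it is harmless, since a
    generating family may be permuted. *)
Lemma exec_drop_rows s k m (E : 'M[data]_(k, s + m)) :
  exec (drop_rows s) (enc_mx E) (enc_mx (rowsub (@rev_ord k) (rsubmx E))).
Proof.
set r := [seq enc_row (row i E) | i <- enum 'I_k].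
have <- : enc_seq (rev (map (iter s tl) r)) = enc_mx (rowsub (@rev_ord k) (rsubmx E)).
  rewrite enc_mxE -map_rev -map_rev rev_enum_ord -[map _ (map (@rev_ord k) _)]map_comp.
  rewrite -[map (iter s tl) _]map_comp; congr enc_seq; apply: eq_map => i /=.
  by rewrite iter_tl_enc_row; congr enc_row; apply/rowP=> j; rewrite !mxE.
apply: ExecSeq; first exact: ExecAssign.
rewrite /= enc_mxE; apply: ExecSeq; first exact: (exec_drop_rows_loop _ _ [::]).
exact: (ExecAssign (ETl EVar) (Cons Nil (enc_seq (rev (map (iter s tl) r))))).
Qed.

(** * Names of matrices *)

Section Naming.

Variables (T : Type) (delta : naming T).

Lemma names_exists k m (M : 'M[T]_(k, m)) : exists D, names delta D M.
Proof.
have [f Hf] := fin_all_exists (fun ij : 'I_k * 'I_m =>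
  decode_surj delta (M ij.1 ij.2)).
by exists (\matrix_(i, j) f (i, j)) => i j; rewrite mxE Hf.
Qed.

Lemma names_row_mx k m n (D1 : 'M_(k, m)) (D2 : 'M_(k, n)) M1 M2 :
  names delta D1 M1 -> names delta D2 M2 ->
  names delta (row_mx D1 D2) (row_mx M1 M2).
Proof.
by move=> H1 H2 i j; case: (split_ordP j) => h ->; rewrite ?row_mxEl ?row_mxEr.
Qed.

Lemma names_mxsub k m k' m' (f : 'I_k' -> 'I_k) (g : 'I_m' -> 'I_m) D M :
  names delta D M -> names delta (mxsub f g D) (mxsub f g M).
Proof. by move=> H i j; rewrite !mxE. Qed.

Lemma names_rsubmx k m n (D : 'M_(k, m + n)) M :
  names delta D M -> names delta (rsubmx D) (rsubmx M).
Proof. by move=> H i j; rewrite !mxE. Qed.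

End Naming.

(** * Ideals and syzygies over the quotient *)

Lemma lincomb_row_mx (A : comNzRingType) m n (l1 mu1 : 'rV[A]_m) (l2 mu2 : 'rV[A]_n) :
  lincomb (row_mx l1 l2) (row_mx mu1 mu2) = lincomb l1 mu1 + lincomb l2 mu2.
Proof.
rewrite /lincomb big_split_ord.
by congr (_ + _); apply: eq_bigr => i _; rewrite ?row_mxEl ?row_mxEr.
Qed.

Section Quotient.

Variables (A : comNzRingType) (I : idealr A) (s : nat) (nu : 'rV[A]_s).
Hypothesis I_gen : forall x, x \in I <-> gen_ideal nu x.

Local Notation Q := {ideal_quot I}.

Lemma map_pi_surj k m (M : 'M[Q]_(k, m)) : exists N, M = map_mx \pi_Q N.
Proof. by exists (map_mx repr M); apply/matrixP=> i j; rewrite !mxE reprK. Qed.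

Lemma names_quot delta k m (D : 'M_(k, m)) (M : 'M[A]_(k, m)) :
  names delta D M -> names (quot_naming I delta) D (map_mx \pi_Q M).
Proof. by move=> H i j; rewrite mxE /= H. Qed.

Lemma quot_name_lift delta d (y : Q) :
  quot_naming I delta d = Some y -> exists2 x, delta d = Some x & y = \pi_Q x.
Proof. by rewrite /=; case: (delta d) => //= x [<-]; exists x. Qed.

(** A tree naming a class already names a representative of it, so a program over the base ring can
    run on the very same trees. *)
Lemma names_quot_lift delta k m (D : 'M_(k, m)) (M : 'M[Q]_(k, m)) :
  names (quot_naming I delta) D M ->
  exists2 N, names delta D N & M = map_mx \pi_Q N.
Proof.
(* The default [0] is never taken: by [H] every entry of [D] decodes. *)
move=> H; exists (\matrix_(i, j) odflt 0 (delta (D i j))).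
  by move=> i j; have [x Dx _] := quot_name_lift (H i j); rewrite mxE Dx.
by apply/matrixP=> i j; have [x Dx ->] := quot_name_lift (H i j); rewrite !mxE Dx.
Qed.

Lemma pi_lincomb m (l mu : 'rV[A]_m) :
  \pi_Q (lincomb l mu) = lincomb (map_mx \pi_Q l) (map_mx \pi_Q mu).
Proof.
by rewrite /lincomb rmorph_sum; apply: eq_bigr => i _; rewrite !mxE rmorphM.
Qed.

Lemma pi_eq0 x : \pi_Q x = 0 <-> gen_ideal nu x.
Proof.
have E : (\pi_Q x == 0) = (x \in I).
  by rewrite -[x in RHS]subr0 Quotient.idealrBE rmorph0.
by split=> [/eqP|/I_gen]; [rewrite E => /I_gen | rewrite -E => /eqP].
Qed.

(** The terms in [nu] sum to an element of [I], which the projection kills. *)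
Lemma pi_lincomb_rsubmx m (l : 'rV[A]_m) (mu : 'rV[A]_(s + m)) :
  \pi_Q (lincomb (row_mx nu l) mu) =
  lincomb (map_mx \pi_Q l) (map_mx \pi_Q (rsubmx mu)).
Proof.
have E : \pi_Q (lincomb nu (lsubmx mu)) = 0 by apply/pi_eq0; exists (lsubmx mu).
by rewrite -[mu in LHS]hsubmxK lincomb_row_mx rmorphD /= E add0r pi_lincomb.
Qed.

Lemma gen_ideal_quot m (l : 'rV[A]_m) x :
  gen_ideal (map_mx \pi_Q l) (\pi_Q x) <-> gen_ideal (row_mx nu l) x.
Proof.
split=> [[mu']|[mu ->]].
  have [mu ->] := map_pi_surj mu'; rewrite -pi_lincomb => /eqP.
  (* The difference between [x] and the lifted combination lies in [I], which supplies the
     coefficients [mu0] on [nu]. *)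
  rewrite -subr_eq0 -rmorphB => /eqP/pi_eq0[mu0 E].
  by exists (row_mx mu0 mu); rewrite lincomb_row_mx -E subrK.
by exists (map_mx \pi_Q (rsubmx mu)); rewrite pi_lincomb_rsubmx.
Qed.

Lemma syz_quot m (l : 'rV[A]_m) (mu : 'rV[A]_m) :
  syz (map_mx \pi_Q l) (map_mx \pi_Q mu) <->
  exists mu0 : 'rV[A]_s, syz (row_mx nu l) (row_mx mu0 mu).
Proof.
rewrite /syz -pi_lincomb; split=> [/pi_eq0[mu0 E]|[mu0 E]].
  (* The value of [lincomb l mu] is a combination of [nu] with coefficients [mu0]; the opposite
     coefficients cancel it. *)
  exists (- mu0); rewrite lincomb_row_mx E /lincomb -big_split big1 // => i _.
  by rewrite /= mxE mulrN addNr.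
by have := pi_lincomb_rsubmx l (row_mx mu0 mu); rewrite E rmorph0 row_mxKr pi_lincomb.
Qed.

Lemma rows_generate_quot m k (l : 'rV[A]_m) (G : 'M[A]_(k, s + m)) :
  rows_generate G (syz (row_mx nu l)) ->
  rows_generate (map_mx \pi_Q (rsubmx G)) (syz (map_mx \pi_Q l)).
Proof.
move=> genG mu'; have [mu ->] := map_pi_surj mu'.
split=> [/syz_quot[mu0 /genG[c E]]|[c']].
  exists (map_mx \pi_Q c); rewrite -map_mxM; congr (map_mx _ _).
  by rewrite -[LHS](row_mxKr mu0) E -[in LHS](hsubmxK G) mul_mx_row row_mxKr.
have [c ->] := map_pi_surj c'; rewrite -map_mxM => E.
(* The missing first entries are the left block of the combination [c *m G]. *)
rewrite E; apply/syz_quot; exists (c *m lsubmx G); apply/genG.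
by exists c; rewrite -mul_mx_row hsubmxK.
Qed.

End Quotient.

Lemma rows_generate_rowsub (A : comNzRingType) m k (f : 'I_k -> 'I_k)
    (G : 'M[A]_(k, m)) M :
  bijective f -> rows_generate G M -> rows_generate (rowsub f G) M.
Proof.
move=> [g fK gK] genG mu; split=> [/genG[c ->]|[c ->]].
  by exists (colsub f c); rewrite mulmx_rowsub_perm //; apply: can_inj fK.
(* The coefficients are moved by the inverse [g], so that permuting them along with the rows by [f]
   gives back [c]. *)
apply/genG; exists (colsub g c); rewrite -(mulmx_rowsub_perm _ G (can_inj fK)).
by congr (_ *m _); apply/matrixP=> i j; rewrite !mxE fK.
Qed.

(** * Correctness of the two algorithms over the quotient *)

Section Programs.

Variables (L : comNzRingType) (delta : naming L) (I : idealr L).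
Variables (s : nat) (nu : 'rV[L]_s) (dnu : 'rV[data]_s).
Hypotheses (I_gen : forall x, x \in I <-> gen_ideal nu x).
Hypothesis dnu_names : names delta dnu nu.

Local Notation snu := [seq dnu ord0 j | j <- enum 'I_s].

Lemma solves_membership_quot p : solves_membership delta p ->
  solves_membership (quot_naming I delta)
    (PSeq (PAssign (ECons (EHd EVar) (prepend snu (ETl EVar))))
       (PSeq p (drop_coeffs s))).
Proof.
move=> Hp m d ds _ _ /quot_name_lift[x dx ->] /names_quot_lift[l Hl ->].
have [out run_p Hout] := Hp _ _ _ _ _ dx (names_row_mx dnu_names Hl).
(* Both answers of [p] share the run up to [drop_coeffs]; only that last stage depends on the
   answer. *)
have run out' : exec (drop_coeffs s) out out' ->
    exec (PSeq (PAssign (ECons (EHd EVar) (prepend snu (ETl EVar))))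
       (PSeq p (drop_coeffs s))) (Cons d (enc_row ds)) out'.
  move=> run_drop; apply: ExecSeq; first exact: ExecAssign.
  by rewrite /= eval_prepend -enc_row_mx; apply: ExecSeq run_p run_drop.
case: Hout => [[E nmem]|[es [mu [E Hes Emu]]]]; rewrite {}E in run.
  exists Nil; first exact/run/exec_drop_coeffs_Nil.
  by left; split=> // /(gen_ideal_quot I_gen).
exists (Cons Nil (enc_row (rsubmx es))).
  by apply: run; rewrite -iter_tl_enc_row; apply: exec_drop_coeffs.
right; exists (rsubmx es), (map_mx \pi_{ideal_quot I} (rsubmx mu)); split=> //.
  exact/names_quot/names_rsubmx.
by rewrite Emu (pi_lincomb_rsubmx I_gen).
Qed.

Lemma solves_syzygies_quot p : solves_syzygies delta p ->
  solves_syzygies (quot_naming I delta)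
    (PSeq (PAssign (prepend snu EVar)) (PSeq p (drop_rows s))).
Proof.
move=> Hp m ds _ /names_quot_lift[l Hl ->].
have [k [E [G [run_p HE genG]]]] := Hp _ _ _ (names_row_mx dnu_names Hl).
exists k, (rowsub (@rev_ord k) (rsubmx E)).
exists (rowsub (@rev_ord k) (map_mx \pi_{ideal_quot I} (rsubmx G))); split.
- apply: ExecSeq; first exact: ExecAssign.
  by rewrite eval_prepend -enc_row_mx; apply: ExecSeq run_p (exec_drop_rows _).
- exact/names_mxsub/names_quot/names_rsubmx.
apply: rows_generate_rowsub; last exact: rows_generate_quot.
by exists (@rev_ord k); apply: rev_ordK.
Qed.

End Programs.

Theorem proposition2p1 (L : comNzRingType) (delta : naming L) (I : idealr L)
    (s : nat) (nu : 'rV[L]_s) :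
  noetherian L ->
  (forall x : L, x \in I <-> gen_ideal nu x) ->
  linear_equations_solvable delta ->
  linear_equations_solvable (quot_naming I delta).
Proof.
(* One choice of names for [nu] is fixed before any input is given, hence may be built into both
   programs. *)
move=> _ I_gen [[p Hp] [q Hq]]; have [dnu dnu_names] := names_exists delta nu.
split; first exact: (ex_intro _ _ (solves_membership_quot I_gen dnu_names Hp)).
exact: (ex_intro _ _ (solves_syzygies_quot I_gen dnu_names Hq)).
Qed.
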